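(* Let $L$ be a finite ranked lattice with rank function $\rho$, and let $(A_1,\dots,A_n)$ be the ordered partition of the atoms of $L$ induced by a multichain $C:\hat{0}=x_0\leq x_1\leq\cdots\leq x_n=\hat{1}$. Suppose that for each $y\in L$ and each $\mathbf{t}\in\mathcal{T}_y^A$ we have $|\operatorname{supp}\mathbf{t}|=\rho(y)$. Then the following are equivalent: (1) for every $x\in L$ with $x\neq\hat{0}$ there is an index $i$ with $|A_i\cap A_x|=1$; (2) for every element $x\in L$ which is the join of two elements of the same block $A_j$, there is an index $i$ with $|A_i\cap A_x|=1$; (3) the multichain $C$ satisfies the meet condition; (4) $\chi(L,t)=t^{\rho(L)-n}\prod_{i=1}^n(t-|A_i|)$.
   Context: The induced partition is $A_i=\{a \text{ an atom of } L: a\leq x_i,\ a\not\leq x_{i-1}\}$ (blocks may be empty). An atomic transversal is a tuple $\mathbf{t}=(t_1,\dots,t_n)$ with $t_i\in A_i\cup\{\hat{0}\}$; $\operatorname{supp}\mathbf{t}$ is the set of indices with $t_i\neq\hat{0}$, and $\mathcal{T}_y^A$ is the set of atomic transversals with $t_1\vee\cdots\vee t_n=y$. $A_x$ is the set of atoms below $x$. An element is atomic if it is a join of atoms. The multichain $C$ satisfies the meet condition if for every atomic $x\in L$ that is neither $\hat{0}$ nor an atom, letting $i$ be the index with $x\leq x_i$ and $x\not\leq x_{i-1}$, we have $x\wedge x_{i-1}\neq\hat{0}$. $\rho(L)$ is the maximum rank, $\mu$ is defined by $\sum_{y\leq x}\mu(y)=\delta_{\hat{0},x}$, and $\chi(L,t)=\sum_{x\in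 L}\mu(x)t^{\rho(L)-\rho(x)}$. *)

(* Defs.v *)
From HB Require Import structures.
From mathcomp Require Export all_boot all_order all_algebra.

Set Implicit Arguments.
Unset Strict Implicit.
Unset Printing Implicit Defensive.

Export Order.TTheory GRing.Theory.
Local Open Scope order_scope.

Section RankedLattice.
Variables (d : Order.disp_t) (L : finTBLatticeType d).
Implicit Types (x y a : L) (rho : L -> nat).

Definition covered : rel L :=
  fun x y => (x < y) && ~~ [exists z : L, (x < z) && (z < y)].

(* The chain itself is x :: s, so that its length is size s. *)
Definition maximal_chain x y (s : seq L) : Prop :=
  path covered x s /\ last x s = y.

(* L is ranked and rho is its rank function: all maximal chains from \bot to x
   have the same length, and this length is rho x (such chains always exist as
   L is finite). *)
Definition rank_function rho : Prop :=
  forall x s, maximal_chain \bot x s -> size s = rho x.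

Definition lattice_rank rho : nat := (\max_(x : L) rho x)%N.

Definition is_atom a : bool := covered \bot a.

Definition atoms_below x : {set L} := [set a | is_atom a & a <= x].

Definition atomic x : Prop :=
  exists S : {set L}, (forall a, a \in S -> is_atom a) /\ x = \join_(a in S) a.

(* k bounds the depth of the recursion; #|L| is enough fuel, see mobius_sum. *)
Fixpoint mobius_rec (k : nat) x : int :=
  if k is k'.+1 then
    ((x == \bot)%:R - \sum_(y : L | (y < x)%O) mobius_rec k' y)%R
  else 0%R.

Definition mobius x : int := mobius_rec #|L| x.

Lemma mobius_rec_stable k m x :
  (#|[set y : L | (y < x)%O]| < k)%N -> (#|[set y : L | (y < x)%O]| < m)%N ->
  mobius_rec k x = mobius_rec m x.
Proof.
elim: k m x => [|k IHk] [|m] x //= ltk ltm; congr (_ - _)%R.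
apply: eq_bigr => y ltyx.
have lt_card : (#|[set z : L | (z < y)%O]| < #|[set z : L | (z < x)%O]|)%N.
  apply: proper_card; apply/properP; split.
    by apply/subsetP=> z; rewrite !inE => /lt_trans; apply.
  by exists y; rewrite !inE // ltxx.
by apply: IHk; apply: leq_trans lt_card _.
Qed.

(* The defining recurrence of the Moebius function. *)
Lemma mobius_sum x : (\sum_(y : L | (y <= x)%O) mobius y = (x == \bot)%:R)%R.
Proof.
have ltL y : (#|[set z : L | (z < y)%O]| < #|L|)%N.
  rewrite -cardsT; apply: proper_card; apply/properP; split; first exact: subsetT.
  by exists y; rewrite !inE // ltxx.
rewrite (bigD1 x) //= {1}/mobius.
rewrite (@mobius_rec_stable _ #|L|.+1) ?ltL //=; last by rewrite ltnW ?ltnS ?ltL.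
rewrite [X in (_ + X)%R](eq_bigl (fun y : L => (y < x)%O)) ?subrK // => y.
by rewrite lt_neqAle andbC.
Qed.

Definition characteristic_poly rho : {poly int} :=
  (\sum_(x : L) mobius x *: 'X^(lattice_rank rho - rho x))%R.

Section Multichain.
Variables (n : nat) (C : 'I_n.+1 -> L).

(* Blocks A_1, ..., A_n are indexed by i : 'I_n, i standing for the index i + 1:
   lower i and upper i are then the elements x_i and x_(i+1) of C. *)
Definition lower (i : 'I_n) : L := C (widen_ord (leqnSn n) i).
Definition upper (i : 'I_n) : L := C (lift ord0 i).

Definition multichain : Prop :=
  [/\ C ord0 = \bot, C ord_max = \top & forall i, lower i <= upper i].

Definition block (i : 'I_n) : {set L} :=
  [set a | is_atom a & (a <= upper i) && ~~ (a <= lower i)].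

Definition supp (t : {ffun 'I_n -> L}) : {set 'I_n} := [set i | t i != \bot].

Definition atomic_transversal (t : {ffun 'I_n -> L}) : bool :=
  [forall i, t i \in \bot |: block i].

(* This is the set T_y^A. *)
Definition transversals y : {set {ffun 'I_n -> L}} :=
  [set t : {ffun 'I_n -> L} | atomic_transversal t & \join_(i < n) t i == y].

Definition has_singleton_block x : Prop :=
  exists i : 'I_n, #|block i :&: atoms_below x| = 1%N.

(* The index i with x <= x_i and x not <= x_(i-1) is unique. *)
Definition meet_condition : Prop :=
  forall x, atomic x -> x != \bot -> ~~ is_atom x ->
  forall i : 'I_n, x <= upper i -> ~~ (x <= lower i) ->
  x `&` lower i != \bot.

End Multichain.
End RankedLattice.

(* Main.v *)
Require Import Defs.
From mathcomp Require Import all_boot all_order all_algebra.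

(* Let S(y) be the sum of (-1)^|supp t| over the transversals t with join y.
   Summing over y <= x, i.e. choosing one atom below x or none in each block,
   gives P(x) = prod_i (1 - |A_i cap A_x|), which vanishes exactly when some
   block has a single atom below x.  As P(bot) = 1, clause (1) says that S = mu,
   while the support hypothesis turns the right-hand side of (4) into
   sum_y S(y) t^(rho(L) - rho(y)).  So (1) implies (4).  Conversely, at the
   least rank where (1) fails, S - mu = P, and an x violating (1) has all its
   atoms in one block, so that P <= 0 on this rank and the equality of
   coefficients forces P = 0.
   For (3) => (1): a block meeting the atoms below x /\ x_k lies below x_k,
   hence a singleton block for x /\ x_k is one for x.  For (2) => (3): if
   x /\ x_(i-1) is bot, all atoms below x lie in A_i, and so do those below the
   join of two of them, which therefore has no singleton block. *)

Set Implicit Arguments.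
Unset Strict Implicit.

Import Num.Theory.

Section FinitePOrder.
Local Open Scope order_scope.
Variables (d : Order.disp_t) (T : finPOrderType d).
Implicit Types x y z : T.

Lemma fin_lt_ind (P : T -> Prop) :
  (forall x, (forall y, y < x -> P y) -> P x) -> forall x, P x.
Proof.
move=> IH x; have [m] := ubnP #|[set y | y < x]|.
elim: m x => // m IHm x le_m; apply: IH => y ltyx; apply: IHm.
apply: leq_trans (le_m : (_ <= m)%N); apply: proper_card; apply/properP; split.
  by apply/subsetP=> z; rewrite !inE => /lt_trans; apply.
by exists y; rewrite !inE // ltxx.
Qed.

Lemma sum_le_lt (V : nmodType) (f : T -> V) x :
  (\sum_(y | (y <= x)%O) f y = f x + \sum_(y | (y < x)%O) f y)%R.
Proof.
rewrite (bigD1 x) //=; congr (_ + _)%R.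
by apply: eq_bigl => y; rewrite lt_neqAle andbC.
Qed.

Lemma eq_from_lower_sums (V : zmodType) (f g : T -> V) x :
  (forall y, y <= x ->
    (\sum_(z | (z <= y)%O) f z = \sum_(z | (z <= y)%O) g z)%R) ->
  f x = g x.
Proof.
elim/fin_lt_ind: x => x IH fg; have := fg x (lexx x); rewrite !sum_le_lt.
rewrite [in LHS](eq_bigr g) => [/addIr //|y ltyx].
by apply: IH => // z zy; apply: fg; apply: le_trans zy (ltW ltyx).
Qed.

End FinitePOrder.

Lemma fin_gt_ind (d : Order.disp_t) (T : finPOrderType d) (P : T -> Prop) :
  (forall x, (forall y, (x < y)%O -> P y) -> P x) -> forall x, P x.
Proof. exact: (@fin_lt_ind _ T^d). Qed.

Section ProductExpansion.
Local Open Scope ring_scope.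

Lemma prod_subr_card (R : comNzRingType) (I T : finType) (z : T)
    (B : I -> {set T}) (u : R) :
  (forall i, z \notin B i) ->
  \prod_i (u - #|B i|%:R) =
  \sum_(t in family (fun i => z |: B i))
    (-1) ^+ #|z.-support t| * u ^+ (#|I| - #|z.-support t|).
Proof.
move=> zNB; pose w a : R := if a == z then u else -1.
have factorE i : u - #|B i|%:R = \sum_(a in z |: B i) w a.
  rewrite big_setU1 //= /w eqxx -sumr_const -sumrN; congr (_ + _).
  by apply: eq_bigr => a aB; rewrite ifN //; apply: contraNneq (zNB i) => <-.
rewrite (eq_bigr _ (fun i _ => factorE i)) bigA_distr_big_dep.
apply: eq_bigr => t _; rewrite (bigID [in z.-support t]) /=; congr (_ * _).
  by rewrite -prodr_const; apply: eq_bigr => i; rewrite inE /w => /negPf->.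
rewrite -(cardC [in z.-support t]) addKn -prodr_const.
by apply: eq_bigr => i; rewrite inE negbK /w => ->.
Qed.

End ProductExpansion.

Section FiniteLattice.
Local Open Scope order_scope.
Variables (d : Order.disp_t) (L : finTBLatticeType d).
Implicit Types x y z a b : L.

Lemma exists_covered z x : z < x -> exists2 y, covered z y & y <= x.
Proof.
elim/fin_lt_ind: x => x IH zx.
have [/existsP[w /andP[zw wx]]|Nzx] := boolP [exists w, (z < w) && (w < x)].
  by have [y zy yw] := IH w wx zw; exists y; rewrite // (le_trans yw (ltW wx)).
by exists x; rewrite // /covered zx.
Qed.

Lemma exists_maximal_chain z x : z <= x -> exists s, maximal_chain z x s.
Proof.
elim/fin_gt_ind: z => z IH; rewrite le_eqVlt => /predU1P[->|zx].
  by exists [::].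
have [y zy yx] := exists_covered zx; case/andP: (zy) => lt_zy _.
by have [s [ps ls]] := IH y lt_zy yx; exists (y :: s); split; rewrite //= zy.
Qed.

Lemma exists_atom_le x : x != \bot -> exists2 a, is_atom a & a <= x.
Proof. by rewrite -lt0x => /exists_covered. Qed.

Lemma atom_neq0 a : is_atom a -> a != \bot.
Proof. by case/andP; rewrite lt0x. Qed.

Lemma atom_le_eq a b : is_atom a -> is_atom b -> a <= b -> a = b.
Proof.
move=> /atom_neq0 a0 /andP[_ /existsPn/(_ a)] + ab.
by rewrite lt0x a0 /= lt_neqAle ab andbT negbK => /eqP.
Qed.

Lemma subset_atoms_below y x : y <= x -> atoms_below y \subset atoms_below x.
Proof.
by move=> yx; apply/subsetP => a; rewrite !inE => /andP[-> /le_trans->].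
Qed.

Lemma atoms_below_gt0 x : x != \bot -> (0 < #|atoms_below x|)%N.
Proof.
by case/exists_atom_le=> a aP ax; apply/card_gt0P; exists a; rewrite inE aP.
Qed.

Lemma atoms_below_atom a : is_atom a -> atoms_below a = [set a].
Proof.
move=> aP; apply/setP => b; rewrite !inE.
by apply/andP/eqP => [[bP]|->//]; apply: atom_le_eq.
Qed.

Definition atomic_part x : L := \join_(a in atoms_below x) a.

Lemma atomic_part_le x : atomic_part x <= x.
Proof. by apply/joinsP => a; rewrite inE => /andP[]. Qed.

Lemma atomic_atomic_part x : atomic (atomic_part x).
Proof. by exists (atoms_below x); split=> // a; rewrite inE => /andP[]. Qed.

Lemma atomic_part_id x : atomic x -> atomic_part x = x.
Proof.
case=> S [SP xE]; apply/le_anti; rewrite atomic_part_le /= {1}xE le_joins //.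
by apply/subsetP => a aS; rewrite inE SP //= xE joins_sup.
Qed.

Lemma atoms_below_atomic_part x : atoms_below (atomic_part x) = atoms_below x.
Proof.
apply/eqP; rewrite eqEsubset subset_atoms_below ?atomic_part_le //=.
by apply/subsetP => a ax; rewrite inE joins_sup // andbT; case/setIdP: ax.
Qed.

Lemma atomic_part_eq0 x : (atomic_part x == \bot) = (x == \bot).
Proof.
apply/idP/idP => [|/eqP->]; last by rewrite -lex0 atomic_part_le.
apply: contraTT => /atoms_below_gt0/card_gt0P[a ax].
have aP : is_atom a by case/setIdP: ax.
by apply: contra (atom_neq0 aP); rewrite -!lex0; apply/le_trans/joins_sup.
Qed.

Lemma atomic_card_gt1 x :
  atomic x -> x != \bot -> ~~ is_atom x -> (1 < #|atoms_below x|)%N.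
Proof.
move=> /atomic_part_id xE x0 NxA; rewrite ltn_neqAle atoms_below_gt0 // andbT.
apply: contra NxA; rewrite eq_sym => /cards1P[a Aa].
have: a \in atoms_below x by rewrite Aa set11.
by rewrite -xE /atomic_part Aa big_set1 inE => /andP[].
Qed.

Section Rank.
Variables (rho : L -> nat) (rhoP : rank_function rho).

Lemma rank_lt z x : z < x -> (rho z < rho x)%N.
Proof.
move=> zx; have [s [ps ls]] := exists_maximal_chain (le0x z).
have [u [pu lu]] := exists_maximal_chain (ltW zx).
rewrite -(rhoP (conj ps ls)) -(@rhoP x (s ++ u)); last first.
  by split; rewrite ?cat_path ?last_cat ls // ps.
rewrite size_cat -addn1 leq_add2l; case: u {pu} lu => //= zx'.
by rewrite zx' ltxx in zx.
Qed.

Lemma rank_eq0 x : (rho x == 0%N) = (x == \bot).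
Proof.
have rho0 : rho \bot = 0%N by rewrite -(@rhoP \bot [::]).
have [->|x0] := eqVneq x \bot; first by rewrite rho0.
by rewrite -lt0x in x0; have := rank_lt x0; rewrite rho0 lt0n => /negPf.
Qed.

End Rank.

Section RankPolynomial.
Variable rho : L -> nat.
Local Open Scope ring_scope.

Definition rank_poly (f : L -> int) : {poly int} :=
  \sum_x f x *: 'X^(lattice_rank rho - rho x).

Lemma rank_le_lattice_rank x : (rho x <= lattice_rank rho)%N.
Proof. exact: (leq_bigmax x). Qed.

Lemma coef_rank_poly (f : L -> int) x :
  (rank_poly f)`_(lattice_rank rho - rho x) = \sum_(y | rho y == rho x) f y.
Proof.
rewrite coef_sumMXn; apply: eq_bigl => y /=.
apply/eqP/eqP => [eq_sub|->//].
by rewrite -(subKn (rank_le_lattice_rank y)) eq_sub subKn ?rank_le_lattice_rank.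
Qed.

Lemma tofrac_rank_poly (f : L -> int) :
  tofrac (rank_poly f) =
  \sum_x (f x)%:~R * tofrac 'X ^+ (lattice_rank rho - rho x).
Proof.
rewrite rmorph_sum; apply: eq_bigr => x _.
by rewrite -mul_polyC -[f x in LHS]intz !rmorphM /= rmorphXn !rmorph_int.
Qed.

End RankPolynomial.

Section Multichain.
Variables (n : nat) (C : 'I_n.+1 -> L).
Implicit Types (i j l : 'I_n) (k : 'I_n.+1) (t : {ffun 'I_n -> L}).

Lemma bot_notin_block i : \bot \notin block C i.
Proof. by rewrite inE !le0x andbF. Qed.

Lemma join_block_neq0 i a b : a \in block C i -> a `|` b != \bot.
Proof.
apply: contraTneq => ab0; have := leUl a b; rewrite ab0 lex0 => /eqP->.
exact: bot_notin_block.
Qed.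

Lemma atoms_below_sub_block x i : x <= upper C i -> x `&` lower C i = \bot ->
  atoms_below x \subset block C i.
Proof.
move=> xi xi0; apply/subsetP => a; rewrite !inE => /andP[aP ax].
rewrite aP (le_trans ax xi) /=; apply: contraL (atom_neq0 aP) => ai.
by rewrite negbK -lex0 -xi0 lexI ax.
Qed.

Definition block_product x : int :=
  (\prod_(i < n) (1 - #|block C i :&: atoms_below x|%:R))%R.

Lemma block_product_eq0 x : block_product x = 0%R <-> has_singleton_block C x.
Proof.
split=> [/eqP/prodf_eq0[i _]|[i ci]].
  by rewrite subr_eq0 eq_sym pnatr_eq1 => /eqP; exists i.
by apply/eqP/prodf_eq0; exists i => //; rewrite ci subrr.
Qed.

Lemma block_product_bot : block_product \bot = 1%R.
Proof.
rewrite /block_product big1 // => i _; rewrite eq_card0 ?subr0 // => a.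
rewrite !inE lex0; apply: contraTF (bot_notin_block i) => /and3P[aC _ /eqP a0].
by rewrite negbK inE -a0.
Qed.

Definition signed_transversals y : int :=
  (\sum_(t in transversals C y) (-1) ^+ #|supp t|)%R.

Lemma sum_transversals (V : nmodType) (P : pred L) (F : {ffun 'I_n -> L} -> V) :
  (\sum_(y | P y) \sum_(t in transversals C y) F t =
   \sum_(t | atomic_transversal C t && P (\join_(i < n) t i)%O) F t)%R.
Proof.
rewrite [RHS](partition_big (fun t => \join_(i < n) t i) P) => [|t /andP[] //].
apply: eq_bigr => y Py; apply: eq_bigl => t; rewrite inE -andbA.
by case: (eqVneq _ y) => [->|]; rewrite ?Py ?andbF.
Qed.

Lemma atomic_transversalE t :
  atomic_transversal C t = (t \in family (fun i => \bot |: block C i)).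
Proof. by apply/forallP/familyP. Qed.

Lemma atomic_transversal_le t x :
  atomic_transversal C t && (\join_(i < n) t i <= x) =
  (t \in family (fun i => \bot |: (block C i :&: atoms_below x))).
Proof.
rewrite atomic_transversalE.
apply/andP/familyP => [[/familyP tC /joinsP tx] i|tCx].
  have := tC i; rewrite !inE; case: eqP => //= _ tCi.
  by rewrite tCi tx // !andbT; case/andP: tCi.
split; first apply/familyP => i; last apply/joinsP => i _; have := tCx i.
  by rewrite !inE; case: eqP => //= _ /andP[].
by rewrite !inE => /predU1P[->|/and3P[]]; rewrite ?le0x.
Qed.

Lemma sum_signed_transversals_le x :
  (\sum_(y | (y <= x)%O) signed_transversals y)%R = block_product x.
Proof.
rewrite sum_transversals /block_product (prod_subr_card (z := \bot)) => [|i].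
  apply: eq_big => t; first exact: atomic_transversal_le.
  by rewrite expr1n mulr1 cardsE.
by rewrite inE (negPf (bot_notin_block i)).
Qed.

Lemma mobius_eq_signed_transversals x :
  (forall y, y <= x -> y != \bot -> has_singleton_block C y) ->
  mobius x = signed_transversals x.
Proof.
move=> sing; apply: eq_from_lower_sums => y yx.
rewrite mobius_sum sum_signed_transversals_le.
have [->|y0] := eqVneq y \bot; first by rewrite block_product_bot.
by apply/esym/block_product_eq0/sing.
Qed.

Definition singleton_below x : Prop :=
  forall y, y < x -> y != \bot -> has_singleton_block C y.

Lemma signed_transversals_sub_mobius x : x != \bot -> singleton_below x ->
  (signed_transversals x - mobius x)%R = block_product x.
Proof.
move=> x0 sing; rewrite -sum_signed_transversals_le.
have := mobius_sum x; rewrite (negPf x0) !sum_le_lt mulr0n => /eqP.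
rewrite addr_eq0 => /eqP->; rewrite opprK; congr (_ + _)%R.
apply: eq_bigr => y yx; apply: mobius_eq_signed_transversals => z zy.
exact/sing/(le_lt_trans zy).
Qed.

Lemma tofrac_rank_poly_signed_transversals (rho : L -> nat) :
  (forall y t, t \in transversals C y -> #|supp t| = rho y) ->
  (tofrac (rank_poly rho signed_transversals) =
   tofrac 'X ^ ((lattice_rank rho)%:Z - n%:Z) *
     \prod_(i < n) tofrac ('X - #|block C i|%:R))%R.
Proof.
move=> supp_rho; rewrite tofrac_rank_poly; set u := tofrac 'X.
have u_neq0 : u != 0%R by rewrite tofrac_eq0 polyX_eq0.
have factorE i : (tofrac ('X - #|block C i|%:R) = u - #|block C i|%:R)%R.
  by rewrite rmorphB rmorph_nat.
rewrite (eq_bigr _ (fun i _ => factorE i)) (prod_subr_card _ bot_notin_block).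
pose F t : {fraction {poly int}} :=
  ((-1) ^+ #|supp t| * u ^+ (lattice_rank rho - #|supp t|))%R.
transitivity (\sum_(y : L) \sum_(t in transversals C y) F t)%R.
  apply: eq_bigr => y _; rewrite rmorph_sum mulr_suml.
  by apply: eq_bigr => t /supp_rho <-; rewrite rmorphXn rmorphN1.
rewrite sum_transversals mulr_sumr.
apply: eq_big => [t|t /andP[tC _]]; first by rewrite andbT atomic_transversalE.
have supp_le_rank : (#|supp t| <= lattice_rank rho)%N.
  rewrite (@supp_rho (\join_(i < n) t i)) ?rank_le_lattice_rank //.
  by rewrite inE tC eqxx.
have supp_le_n : (#|supp t| <= n)%N by rewrite -[n in leqRHS]card_ord max_card.
rewrite /F -[#|_.-support _|]cardsE card_ord [RHS]mulrCA; congr (_ * _)%R.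
by rewrite !exprnP -expfzDr // -!subzn // addrA subrK.
Qed.

Hypothesis CP : multichain C.

Lemma multichain_le k k' : (k <= k')%N -> C k <= C k'.
Proof.
case: k' => m; elim: m => [|m IHm] lt_m /=.
  by rewrite leqn0 => /eqP k0; have -> : k = Ordinal lt_m by apply: val_inj.
rewrite leq_eqVlt => /predU1P[kE|].
  by have -> : k = Ordinal lt_m by apply: val_inj.
rewrite ltnS => /(IHm (ltnW lt_m))/le_trans; apply.
case: CP => _ _ /(_ (Ordinal (lt_m : (m < n)%N))); rewrite /lower /upper.
by congr (C _ <= C _); apply: val_inj.
Qed.

Lemma exists_upper_lower x :
  x != \bot -> exists i, (x <= upper C i) && ~~ (x <= lower C i).
Proof.
case: CP => C0 C1 _ x0.
have: x <= C ord_max by rewrite C1 lex1.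
case/(@arg_minnP _ _ (fun k => x <= C k) (@nat_of_ord _)) => k xk kmin.
case: (unliftP ord0 k) => [i kE|kE]; last first.
  by rewrite kE C0 lex0 (negPf x0) in xk.
exists i; rewrite /upper -kE xk /=; apply/negP => /kmin /=.
by rewrite kE lift0 ltnn.
Qed.

Lemma block_le_multichain i k a : a \in block C i -> (a <= C k) = (i < k)%N.
Proof.
rewrite inE => /andP[_ /andP[aui Nali]]; apply/idP/idP => [ak|ik].
  rewrite ltnNge; apply: contra Nali => ki; apply: le_trans ak _.
  exact: multichain_le.
by apply: le_trans aui _; apply: multichain_le; rewrite lift0.
Qed.

Lemma block_inj i j a : a \in block C i -> a \in block C j -> i = j.
Proof.
have block_le l l' : a \in block C l -> a \in block C l' -> (l <= l')%N.
  move=> /block_le_multichain al; rewrite inE => /andP[_ /andP[]].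
  by rewrite al lift0.
by move=> ai aj; apply/val_inj/anti_leq; rewrite !block_le.
Qed.

Lemma has_singleton_block_meet x k :
  has_singleton_block C (x `&` C k) -> has_singleton_block C x.
Proof.
case=> i card1; exists i; rewrite -card1; apply: eq_card => a.
have ik : (i < k)%N.
  have /card_gt0P[c /setIP[ci]] :
      (0 < #|block C i :&: atoms_below (x `&` C k)|)%N by rewrite card1.
  by rewrite inE lexI => /and3P[_ _]; rewrite (block_le_multichain _ ci).
rewrite !in_setI; case ai: (a \in block C i) => //=.
by rewrite !inE lexI (block_le_multichain k ai) ik andbT.
Qed.

Lemma singleton_below_meet x i : singleton_below x ->
  ~~ (x <= lower C i) -> x `&` lower C i != \bot -> has_singleton_block C x.
Proof.
move=> sing Nxi xi0; apply: has_singleton_block_meet (sing _ _ xi0).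
by rewrite lt_leAnge leIl leIidl.
Qed.

Lemma block_product_one_block x i : atoms_below x \subset block C i ->
  (block_product x = 1 - #|atoms_below x|%:R)%R.
Proof.
move=> sub; rewrite /block_product (bigD1 i) //= (setIidPr sub).
rewrite big1 ?mulr1 // => j ji; rewrite eq_card0 ?subr0 // => a.
rewrite in_setI; apply: contra_neqF ji => /andP[aj /(subsetP sub) ai].
exact: block_inj aj ai.
Qed.

Lemma block_product_le0 x :
  x != \bot -> singleton_below x -> (block_product x <= 0)%R.
Proof.
move=> x0 sing; have [i /andP[xi Nxi]] := exists_upper_lower x0.
have [xi0|xi0] := eqVneq (x `&` lower C i) \bot; last first.
  by have /block_product_eq0-> := singleton_below_meet sing Nxi xi0.
rewrite (block_product_one_block (atoms_below_sub_block xi xi0)).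
by rewrite subr_le0 ler1n atoms_below_gt0.
Qed.

Lemma singleton_block_joins_meet_condition :
  (forall x, (exists j a b,
      [/\ a \in block C j, b \in block C j, a <> b & x = a `|` b]) ->
    has_singleton_block C x) ->
  meet_condition C.
Proof.
move=> joins_sing x xA x0 NxA i xi _; apply/negP => /eqP xi0.
have sub_x := atoms_below_sub_block xi xi0.
have /card_gt1P[a [b [ax bx ab]]] := atomic_card_gt1 xA x0 NxA.
case/setIdP: (ax) (ax) (bx) => aP le_ax _; case/setIdP=> bP le_bx.
have sub_ab : atoms_below (a `|` b) \subset block C i.
  by apply: subset_trans sub_x; rewrite subset_atoms_below // leUx le_ax.
have /block_product_eq0/eqP : has_singleton_block C (a `|` b).
  apply: joins_sing; exists i, a, b.
  by split; rewrite ?(subsetP sub_x) //; apply/eqP.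
rewrite (block_product_one_block sub_ab) subr_eq0 eq_sym pnatr_eq1; apply/negP.
rewrite eq_sym neq_ltn; apply/orP; left.
by apply/card_gt1P; exists a, b; split; rewrite // inE ?aP ?bP ?leUl ?leUr.
Qed.

Lemma atomic_has_singleton_block x : meet_condition C -> atomic x ->
  x != \bot -> singleton_below x -> has_singleton_block C x.
Proof.
move=> MC xA x0 sing; have [i /andP[xi Nxi]] := exists_upper_lower x0.
have [xP|NxP] := boolP (is_atom x); last first.
  exact/(singleton_below_meet sing Nxi)/MC.
exists i; rewrite (atoms_below_atom xP) (setIidPr _) ?cards1 // sub1set.
by rewrite inE xP xi.
Qed.

Lemma meet_condition_has_singleton_block x :
  meet_condition C -> x != \bot -> has_singleton_block C x.
Proof.
move=> MC; elim/fin_lt_ind: x => x IH x0.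
suff [i] : has_singleton_block C (atomic_part x).
  by rewrite atoms_below_atomic_part; exists i.
apply: atomic_has_singleton_block; rewrite ?atomic_part_eq0 //.
  exact: atomic_atomic_part.
by move=> y ltyx; apply/IH/(lt_le_trans ltyx)/atomic_part_le.
Qed.

Section RankComparison.
Variables (rho : L -> nat) (rhoP : rank_function rho).

Lemma rank_sum_has_singleton_block x : x != \bot ->
  (forall y, (rho y < rho x)%N -> y != \bot -> has_singleton_block C y) ->
  (\sum_(y | rho y == rho x) mobius y =
   \sum_(y | rho y == rho x) signed_transversals y)%R ->
  has_singleton_block C x.
Proof.
move=> x0 sing eq_sums.
have same_rank y : rho y == rho x -> y != \bot /\ singleton_below y.
  move=> /eqP yx; split=> [|z zy].
    by rewrite -(rank_eq0 rhoP) yx rank_eq0.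
  by apply: sing; rewrite -yx (rank_lt rhoP).
have opp_ge0 y : rho y == rho x -> (0 <= - block_product y)%R.
  by case/same_rank=> y0 singy; rewrite oppr_ge0 block_product_le0.
have sum_eq0 : (\sum_(y | rho y == rho x) - block_product y = 0)%R.
  rewrite (eq_bigr (fun y => mobius y - signed_transversals y)%R).
    by rewrite sumrB eq_sums subrr.
  move=> y /same_rank[y0 singy].
  by rewrite -signed_transversals_sub_mobius ?opprB.
apply/block_product_eq0/oppr_inj; rewrite oppr0.
exact: (psumr_eq0P opp_ge0 sum_eq0).
Qed.

Lemma rank_poly_has_singleton_block :
  rank_poly rho (@mobius _ L) = rank_poly rho signed_transversals ->
  forall x, x != \bot -> has_singleton_block C x.
Proof.
move=> eq_poly x; have [m] := ubnP (rho x); elim: m x => // m IHm x le_xm x0.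
apply: rank_sum_has_singleton_block => // [y lt_yx|].
  by apply: IHm; apply: leq_trans lt_yx le_xm.
by rewrite -!coef_rank_poly eq_poly.
Qed.

End RankComparison.
End Multichain.
End FiniteLattice.

(* Clause (4) is an identity of rational functions, as the exponent
   rho(L) - n may be negative (blocks may be empty). *)
Theorem theorem5p4 (d : Order.disp_t) (L : finTBLatticeType d)
  (rho : L -> nat) (n : nat) (C : 'I_n.+1 -> L)
  (rhoP : rank_function rho) (CP : multichain C)
  (supp_rho : forall (y : L) (t : {ffun 'I_n -> L}),
     t \in transversals C y -> #|supp t| = rho y) :
  [<-> forall x : L, x <> Order.bottom -> has_singleton_block C x;
       forall x : L,
         (exists (j : 'I_n) (a b : L),
            [/\ a \in block C j, b \in block C j, a <> b & x = Order.join a b]) ->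
         has_singleton_block C x;
       meet_condition C;
       (tofrac (characteristic_poly rho) =
          tofrac 'X ^ ((lattice_rank rho)%:Z - n%:Z) *
          \prod_(i < n) tofrac ('X - #|block C i|%:R)
        :> {fraction {poly int}})%R].
Proof.
rewrite -(tofrac_rank_poly_signed_transversals supp_rho); tfae.
- move=> sing x [j [a [b [aj _ _ ->]]]].
  exact/sing/eqP/(join_block_neq0 b aj).
- exact: singleton_block_joins_meet_condition.
- move=> MC; congr (tofrac _); apply: eq_bigr => x _; congr (_ *: _)%R.
  apply: mobius_eq_signed_transversals => y _.
  exact: meet_condition_has_singleton_block.
- move/eqP; rewrite tofrac_eq => /eqP eq_poly x /eqP.
  exact: rank_poly_has_singleton_block rhoP eq_poly x.
Qed.
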